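(* Let $\mathbf{p}=(p_j)_{1\le j\le r}$ and $\mathbf{q}=(q_j)_{1\le j\le r}$ be the class-conditional distributions of $X$ given $Y=1$ and $Y=0$, with $p_j>0$ and $q_j>0$ for all $j\in D=\{1,\dots,r\}$. Let $\hat{\mathbf{p}}_n$ and $\hat{\mathbf{q}}_m$ be the empirical class-conditional distributions generated by an i.i.d. sample $(X_1,Y_1),\dots,(X_N,Y_N)$ from $\mathbb{P}$. Then, almost surely, $$\limsup_{(n,m)\to(+\infty,+\infty)}\frac{|J(\hat{\mathbf{p}}_n,\hat{\mathbf{q}}_m)-J(\mathbf{p},\mathbf{q})|}{C_{n,m}}\le\sum_{j\in D}\bigg\{\Big|1+\ln\frac{p_j}{q_j}\Big|+\Big|1+\ln\frac{q_j}{p_j}\Big|+\frac{p_j^2+q_j^2}{p_j\,q_j}\bigg\}.$$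
   Context: Let $S=\{a_1,\dots,a_r\}$ be a finite set (of bins), $D=\{1,\dots,r\}$, and let $(X,Y)$ be a random vector with values in $S\times\{0,1\}$ and distribution $\mathbb{P}$, with $0<\mathbb{P}(Y=1)<1$. Define $p_j=\mathbb{P}(X=a_j\mid Y=1)$ and $q_j=\mathbb{P}(X=a_j\mid Y=0)$ for $j\in D$. Given an i.i.d. sample $(X_1,Y_1),\dots,(X_N,Y_N)$ from $\mathbb{P}$, let $n=\sum_{i=1}^N\mathbf{I}[Y_i=1]$ and $m=N-n$, where $\mathbf{I}[\cdot]$ denotes the indicator. The empirical distributions are $\hat{\mathbf{p}}_n=(\hat p_n^{\,a_j})_{j\in D}$ and $\hat{\mathbf{q}}_m=(\hat q_m^{\,a_j})_{j\in D}$ with $$\hat p_n^{\,a_j}=\frac1n\sum_{i=1}^N\mathbf{I}[X_i=a_j]\,\mathbf{I}[Y_i=1],\qquad \hat q_m^{\,a_j}=\frac1m\sum_{i=1}^N\mathbf{I}[X_i=a_j]\,\mathbf{I}[Y_i=0].$$ Here $n$ and $m$ depend on $N$, and limits as $(n,m)\to(+\infty,+\infty)$ are taken along $N\to\infty$. The Jeffreys divergence is $J(\mathbf{p},\mathbf{q})=\sum_{j\in D}(p_j-q_j)\ln\frac{p_j}{q_j}$, and its plug-in estimator (the Information Value) is $J(\hat{\mathbf{p}}_n,\hat{\mathbf{q}}_m)=\sum_{j\in D}(\hat p_n^{\,a_j}-\hat q_m^{\,a_j})\ln\frac{\hat p_n^{\,a_j}}{\hat q_m^{\,a_j}}$. Put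 $A_n=\sup_{j\in D}|\hat p_n^{\,a_j}-p_j|$, $B_m=\sup_{j\in D}|\hat q_m^{\,a_j}-q_j|$ and $C_{n,m}=\max\{A_n,B_m\}$. *)

(* Defs.v *)
From HB Require Import structures.
From mathcomp Require Import all_boot all_order all_algebra finmap.
From mathcomp Require Import all_classical all_reals all_analysis.

Set Implicit Arguments.
Unset Strict Implicit.
Unset Printing Implicit Defensive.
Import Order.TTheory GRing.Theory Num.Theory.
Local Open Scope classical_set_scope.
Local Open Scope ring_scope.

Section Probability.
Context {d : measure_display} {Omega : measurableType d} {R : realType}.
Variable P : probability Omega R.

(* The codomain carries the sigma-algebra of all its subsets; here it is
   always a finite set. *)
Definition discrete_rv {T : Type} (Z : Omega -> T) : Prop :=
  forall A : set T, measurable (Z @^-1` A).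

Definition identically_distributed {T : Type} (Z Z' : Omega -> T) : Prop :=
  forall A : set T, P (Z @^-1` A) = P (Z' @^-1` A).

Definition mutually_independent {T : Type} (Z : nat -> Omega -> T) : Prop :=
  forall (I : {fset nat}) (A : nat -> set T),
    P (\bigcap_(i in [set` I]) (Z i @^-1` A i)) =
    (\prod_(i <- I) P (Z i @^-1` A i))%E.

Definition iid_sample {T : Type} (Z0 : Omega -> T) (Z : nat -> Omega -> T) :
    Prop :=
  [/\ forall i, discrete_rv (Z i),
      forall i, identically_distributed (Z i) Z0 &
      mutually_independent Z].

Definition cond_prob (A B : set Omega) : R :=
  fine (P (A `&` B)) / fine (P B).

End Probability.

(* [class_cond P a XY y j] is P(X = a_j | Y = y) for XY = (X, Y); the values
   1 and 0 of Y are encoded by [true] and [false]. *)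
Definition class_cond {d : measure_display} {Omega : measurableType d}
    {R : realType} (P : probability Omega R) {S : finType} {r : nat}
    (a : 'I_r -> S) (XY : Omega -> S * bool) (y : bool) (j : 'I_r) : R :=
  cond_prob P [set w | (XY w).1 = a j] [set w | (XY w).2 = y].

Section Empirical.
Context {R : realType} {S : finType} {r : nat}.
Variable a : 'I_r -> S.
(* A realization (x_i, y_i)_i of the sample; the first N terms are used. *)
Variable z : nat -> S * bool.

Definition class_count (N : nat) (y : bool) : nat :=
  (\sum_(i < N) ((z i).2 == y))%N.

(* Is 0 when [class_count N y] = 0, division by 0 being 0. *)
Definition empirical (N : nat) (y : bool) (j : 'I_r) : R :=
  (class_count N y)%:R^-1 *
  \sum_(i < N) ((z i).1 == a j)%:R * ((z i).2 == y)%:R.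

End Empirical.

(* [ln] and the division are total, both with value 0 at 0, so a term with
   p_j = 0 or q_j = 0 counts for 0. When p and q are positive, the empirical
   distributions are almost surely positive for all large N, so this choice
   affects no limit as N tends to infinity. *)
Definition jeffreys {R : realType} {r : nat} (p q : 'I_r -> R) : R :=
  \sum_(j < r) (p j - q j) * ln (p j / q j).

(* The default 0 of the iterated maximum is harmless: the terms are
   nonnegative. *)
Definition sup_dist {R : realType} {r : nat} (p q : 'I_r -> R) : R :=
  \big[Num.max/0]_(j < r) `|p j - q j|.

(* Main.v *)
(* Almost surely the empirical distributions converge to p and q: the exponential
   moment of a binomial count is computed from the probabilities of finite
   intersections alone, so Chernoff's bound makes the large deviations of a
   frequency summable and Borel-Cantelli applies.  Along a convergent realization
   the limsup is at most the l^1-norm of the gradient of J at (p, q), whose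
   components are 1 + ln (p_j/q_j) - q_j/p_j and 1 + ln (q_j/p_j) - p_j/q_j; the
   triangle inequality and q_j/p_j + p_j/q_j = (p_j^2 + q_j^2)/(p_j q_j) conclude. *)
Require Import Defs.
From mathcomp Require Import all_boot all_order all_algebra finmap.
From mathcomp Require Import all_classical all_reals all_analysis.
From mathcomp Require Import measurable_realfun ring lra.

Set Implicit Arguments.
Unset Strict Implicit.
Unset Printing Implicit Defensive.
Import Order.TTheory GRing.Theory Num.Theory.
Import numFieldNormedType.Exports.
Local Open Scope classical_set_scope.
Local Open Scope ring_scope.

(** * Real analysis: the limsup along convergent sequences, and the base of the Chernoff bound *)

Lemma limn_esup_le {R : realType} (u : (\bar R)^nat) (l : R) :
  (forall e : R, 0 < e -> \forall n \near \oo, (u n <= (l + e)%:E)%E) ->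
  (limn_esup u <= l%:E)%E.
Proof.
move=> ule; apply/lee_addgt0Pr => e e0; rewrite -EFinD.
(* [limn_esup] is an infimum, over the sets of the filter, of suprema of [u]; the set where the
   bound holds is one of them. *)
apply: (@le_trans _ _ (ereal_sup (u @` [set n | (u n <= (l + e)%:E)%E]))).
  by apply: ereal_inf_lbound; exists [set n | (u n <= (l + e)%:E)%E] => //; exact: ule.
by apply: ge_ereal_sup => _ [n /= une <-].
Qed.

(* With [ln x - ln p = g x * (x - p)] and [ln y - ln q = h y * (y - q)], [g] and
   [h] continuous, the difference equals
   [(ln (p/q) + (x-y) g x) (x-p) - (ln (p/q) + (x-y) h y) (y-q)]. *)
Lemma jeffreys_term_lipschitz {R : realType} (p q : R) (x y : R^nat) :
  0 < p -> 0 < q -> x @ \oo --> p -> y @ \oo --> q ->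
  exists K : R^nat, [/\ forall n, 0 <= K n,
    K @ \oo --> `|1 + ln (p / q) - q / p| + `|1 + ln (q / p) - p / q| &
    \forall n \near \oo,
      `|(x n - y n) * ln (x n / y n) - (p - q) * ln (p / q)|
        <= K n * Num.max `|x n - p| `|y n - q|].
Proof.
move=> p0 q0 xp yq.
(* Carathéodory's form of differentiability: the slope [g] is continuous at [p] with value [p^-1],
   which gives the limit of [al]; likewise [h] at [q] for [be]. *)
have /is_derive1_caratheodory [g [gE gc gp]] := is_derive1_ln p0.
have /is_derive1_caratheodory [h [hE hc hq]] := is_derive1_ln q0.
pose al n := ln (p / q) + (x n - y n) * g (x n).
pose be n := ln (p / q) + (x n - y n) * h (y n).
exists (fun n => `|al n| + `|be n|); split => [n||].
- by rewrite addr_ge0.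
- have gx : g (x n) @[n --> \oo] --> p^-1 by rewrite -gp; exact: continuous_cvg.
  have hy : h (y n) @[n --> \oo] --> q^-1 by rewrite -hq; exact: continuous_cvg.
  have -> : 1 + ln (p / q) - q / p = ln (p / q) + (p - q) * p^-1.
    by field; rewrite gt_eqF.
  (* The limit of [be] is minus the second partial derivative; the absolute value absorbs the
     sign. *)
  have -> : `|1 + ln (q / p) - p / q| = `|ln (p / q) + (p - q) * q^-1|.
    have -> : ln (q / p) = - ln (p / q) by rewrite -lnV ?posrE ?divr_gt0// invf_div.
    by rewrite -normrN; congr `|_|; field; rewrite gt_eqF.
  by apply: cvgD; apply: cvg_norm; apply: cvgD; [exact: cvg_cst| |exact: cvg_cst|];
    apply: cvgM => //; exact: cvgB.
- near=> n.
  have xn0 : 0 < x n by near: n; exact: cvgr_gt xp _ p0.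
  have yn0 : 0 < y n by near: n; exact: cvgr_gt yq _ q0.
  have -> : (x n - y n) * ln (x n / y n) - (p - q) * ln (p / q) =
      al n * (x n - p) - be n * (y n - q).
    rewrite /al /be !ln_div ?posrE// !mulrDl -!mulrA -gE -hE; ring.
  rewrite (le_trans (ler_normB _ _))// !normrM mulrDl lerD// ler_wpM2l//.
    by rewrite le_max lexx.
  by rewrite le_max lexx orbT.
Unshelve. all: by end_near.
Qed.

Lemma sup_dist_ge {R : realType} {r : nat} (p q : 'I_r -> R) (j : 'I_r) :
  `|p j - q j| <= sup_dist p q.
Proof. exact: (le_bigmax _ (fun j => `|p j - q j|)). Qed.

(** The termwise estimates add up: every local maximum is at most [C], and the finite sum of the
    coefficients [K j] converges to the bound. *)
Lemma jeffreys_limsup {R : realType} {r : nat} (p q : 'I_r -> R)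
    (x y : nat -> 'I_r -> R) :
  (forall j, 0 < p j) -> (forall j, 0 < q j) ->
  (forall j, x N j @[N --> \oo] --> p j) ->
  (forall j, y N j @[N --> \oo] --> q j) ->
  (limn_esup (fun N => (`|jeffreys (x N) (y N) - jeffreys p q| /
      Num.max (sup_dist (x N) p) (sup_dist (y N) q))%:E)
   <= (\sum_(j < r) (`|1 + ln (p j / q j) - q j / p j| +
                     `|1 + ln (q j / p j) - p j / q j|))%:E)%E.
Proof.
move=> p0 q0 xp yq; apply: limn_esup_le => e e0.
have /fin_all_exists[K KP] j :=
  jeffreys_term_lipschitz (p0 j) (q0 j) (xp j) (yq j).
have Kcvg : \sum_(j < r) K j N @[N --> \oo] -->
    \sum_(j < r) (`|1 + ln (p j / q j) - q j / p j| +
                  `|1 + ln (q j / p j) - p j / q j|).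
  by apply: cvg_big => [|j _]; [exact: add_continuous|case: (KP j)].
have KL : \forall N \near \oo, forall j,
    `|(x N j - y N j) * ln (x N j / y N j) - (p j - q j) * ln (p j / q j)|
      <= K j N * Num.max `|x N j - p j| `|y N j - q j|.
  by apply: filter_forall => j; case: (KP j).
near=> N; rewrite lee_fin.
apply: (@le_trans _ _ (\sum_(j < r) K j N)); last first.
  by near: N; apply: cvgr_le Kcvg _ _; rewrite ltrDl.
set C := Num.max _ _.
have C0 : 0 <= C by rewrite le_max; apply/orP; left; exact: bigmax_ge_id.
have JC : `|jeffreys (x N) (y N) - jeffreys p q| <= (\sum_(j < r) K j N) * C.
  rewrite /jeffreys -sumrB mulr_suml (le_trans (ler_norm_sum _ _ _))//.
  apply: ler_sum => j _.
  apply: (@le_trans _ _ (K j N * Num.max `|x N j - p j| `|y N j - q j|)).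
    exact: (near KL N).
  rewrite ler_wpM2l//; first by case: (KP j).
  by rewrite ge_max /C !le_max !sup_dist_ge orbT.
(* If [C = 0] the quotient is 0 by convention, and the coefficients are nonnegative. *)
have [C00|Cn0] := eqVneq C 0.
  by rewrite C00 invr0 mulr0 sumr_ge0// => j _; case: (KP j).
by rewrite ler_pdivrMr// lt_neqAle eq_sym Cn0.
Unshelve. all: by end_near.
Qed.

(* For small [u] the base of the Chernoff bound is
   [1 - u (c - p) + o(u)]; [u = ln (1 + t)] avoids computing [o(u)]. *)
Lemma tilt_lt1 {R : realType} (p c : R) : 0 <= p < c ->
  exists2 u : R, 0 <= u & (1 + (expR u - 1) * p) / expR (u * c) < 1.
Proof.
(* This [t] solves [p * (1 + t) = c - t], hence [p * (1 + t) < c]. Combined with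
   [1 + t * p <= expR (t * p)] and [t / (1 + t) <= ln (1 + t)], this gives the claim. *)
move=> /andP[p0 pc]; pose t := (c - p) / (p + 1).
have t0 : 0 < t by rewrite divr_gt0 ?subr_gt0 ?ltr_wpDl.
have t10 : 0 < 1 + t by rewrite addr_gt0.
have ptc : p * (1 + t) < c.
  have -> : p * (1 + t) = c - t by rewrite /t; field; rewrite gt_eqF// ltr_wpDl.
  by rewrite ltrBlDr ltrDl.
exists (ln (1 + t)); first by rewrite ln_ge0// lerDl ltW.
rewrite ltr_pdivrMr ?expR_gt0// mul1r lnK ?posrE// [1 + t]addrC addrK.
rewrite (le_lt_trans (expR_ge1Dx _))// ltr_expR.
have : t / (1 + t) <= ln (1 + t).
  have := expR_ge1Dx (- ln (1 + t)); rewrite expRN lnK ?posrE//.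
  have -> : t / (1 + t) = 1 - (1 + t)^-1 by field; rewrite gt_eqF.
  by rewrite lerBlDr lerBlDl.
have c0 : 0 < c by exact: le_lt_trans pc.
move=> /(ler_wpM2r (ltW c0)); rewrite [t + 1]addrC; apply: lt_le_trans.
by rewrite [ltRHS]mulrAC ltr_pdivlMr// -mulrA ltr_pM2l.
Qed.

(** * Strong law of large numbers for frequencies *)

Section LargeNumbers.
Context {d : measure_display} {Omega : measurableType d} {R : realType}.
Variables (P : probability Omega R) (T : Type) (Z0 : Omega -> T).
Variable Z : nat -> Omega -> T.
Hypothesis hZ : iid_sample P Z0 Z.
Implicit Type b : pred T.

Local Notation prb b := (fine (P (Z0 @^-1` [set x | b x]))).

Let measurable_event b i : measurable [set w | b (Z i w)].
Proof. by case: hZ => mZ _ _; exact: (mZ i [set x | b x]). Qed.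

Let event_prob b i : P [set w | b (Z i w)] = (prb b)%:E.
Proof.
case: hZ => mZ idZ _; rewrite -(idZ i) fineK//.
apply: fin_num_measure; exact: mZ.
Qed.

Let measurable_indicator b i :
  measurable_fun [set: Omega] (fun w => (b (Z i w))%:R : R).
Proof.
rewrite (_ : (fun w => _) = \1_([set w | b (Z i w)])).
  exact: measurable_indic.
apply/funext => w; rewrite indicE; congr (_ *+ nat_of_bool _).
by apply/idP/idP; rewrite inE.
Qed.

(* The index set [I], disjoint from [0, N), makes the induction on [N] go
   through: expanding the last factor moves [N] into [I]. *)
Lemma expectation_prod_tilt b (t : R) (N : nat) (I : {fset nat}) :
  0 <= t -> (forall i, i \in I -> (N <= i)%N) ->
  (\int[P]_w (\prod_(i <- I) (b (Z i w))%:R *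
              \prod_(i < N) (1 + t * (b (Z i w))%:R))%:E =
   (prb b ^+ #|` I| * (1 + t * prb b) ^+ N)%:E)%E.
Proof.
move=> t0; elim: N I => [|N IH] I NI.
  under eq_integral do rewrite big_ord0 mulr1.
  case: hZ => mZ idZ /(_ I (fun=> [set x | b x])) indep.
  rewrite expr0 mulr1.
  transitivity (P (\bigcap_(i in [set` I]) (Z i @^-1` [set x | b x]))).
    rewrite -[X in P X]setIT -integral_indic//; last first.
      by apply: bigcap_measurableType => k _; exact: mZ.
    apply: eq_integral => w _; congr EFin; rewrite indicE.
    case: (boolP (w \in _)) => [|/negP].
      rewrite inE => wI; rewrite big_seq big1// => i iI.
      by rewrite (wI i iI).
    rewrite inE => /existsNP[i /not_implyP[iI /negP bi]].
    by rewrite (big_rem i)//= (negbTE bi) mul0r.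
  rewrite indep; under eq_bigr do rewrite event_prob.
  by rewrite prodEFin big_const_seq count_predT -Monoid.iteropE.
have NI' : N \notin I by apply/negP => /NI; rewrite ltnn.
have IN i : i \in I -> (N <= i)%N by move=> /NI /ltnW.
have NIN i : i \in (N |` I)%fset -> (N <= i)%N.
  by rewrite in_fset1U => /predU1P[->|/IN].
have ge0 (J : {fset nat}) w : (0 <= (\prod_(i <- J) (b (Z i w))%:R *
              \prod_(i < N) (1 + t * (b (Z i w))%:R))%:E :> \bar R)%E.
  rewrite lee_fin mulr_ge0// prodr_ge0// => i _.
  by rewrite addr_ge0// mulr_ge0.
have mf (J : {fset nat}) : measurable_fun [set: Omega] (fun w =>
   (\prod_(i <- J) (b (Z i w))%:R *
     \prod_(i < N) (1 + t * (b (Z i w))%:R))%:E : \bar R).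
  apply/measurable_EFinP/measurable_funM; apply: measurable_prod => // i _.
  by apply: measurable_funD => //; exact: measurable_funM.
transitivity (\int[P]_w ((\prod_(i <- I) (b (Z i w))%:R *
              \prod_(i < N) (1 + t * (b (Z i w))%:R))%:E + t%:E *
  (\prod_(i <- (N |` I)%fset) (b (Z i w))%:R *
              \prod_(i < N) (1 + t * (b (Z i w))%:R))%:E))%E.
  apply: eq_integral => w _; rewrite -EFinM -EFinD; congr EFin.
  rewrite big_ord_recr/= big_fsetU1//=; ring.
(* As [0 <= t], both summands are nonnegative, so linearity requires only measurability. *)
rewrite ge0_integralD//; last 2 first.
- by move=> w _; rewrite mule_ge0.
- exact: measurable_funeM.
rewrite ge0_integralZl// IH// IH// cardfsU1 NI' -EFinM -EFinD; congr EFin.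
rewrite exprS add1n exprS; ring.
Qed.

(** Since [b] takes the values 0 and 1, [expR (u * b) = 1 + (expR u - 1) * b]: this is the tilted
    product with [t = expR u - 1] and empty [I]. *)
Lemma expectation_exp_count b (u : R) (N : nat) : 0 <= u ->
  (\int[P]_w (expR (u * (\sum_(i < N) b (Z i w))%N%:R))%:E =
   ((1 + (expR u - 1) * prb b) ^+ N)%:E)%E.
Proof.
move=> u0; have t0 : 0 <= expR u - 1 by rewrite subr_ge0 -expR0 ler_expR.
have := @expectation_prod_tilt b _ N fset0 t0.
rewrite cardfs0 expr0 mul1r => <-//; apply: eq_integral => w _; congr EFin.
rewrite big_seq_fset0 mul1r natr_sum mulr_sumr expR_sum.
by apply: eq_bigr => i _; case: (b _); rewrite ?mulr1 ?mulr0 ?expR0; ring.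
Qed.

Let measurable_count b N : measurable_fun [set: Omega]
  (fun w => (\sum_(i < N) b (Z i w))%N%:R : R).
Proof. by under eq_fun do rewrite natr_sum; exact: measurable_sum. Qed.

Let measurable_tail b (c : R) N :
  measurable [set w | c * N%:R <= (\sum_(i < N) b (Z i w))%N%:R].
Proof.
rewrite (_ : [set w | _] = (fun w => (\sum_(i < N) b (Z i w))%N%:R : R) @^-1`
    `[c * N%:R, +oo[); last first.
  by apply/seteqP; split => w /=; rewrite in_itv/= andbT.
by rewrite -[X in measurable X]setTI; exact: measurable_count.
Qed.

(** Markov's inequality for the exponential of [u] times the count: on the event, it is at least
    [expR (u * c * N)]. *)
Lemma count_tail_le b (c u : R) N : 0 <= u ->
  (P [set w | (c * N%:R <= (\sum_(i < N) b (Z i w))%N%:R)%R] <=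
   (((1 + (expR u - 1) * prb b) / expR (u * c)) ^+ N)%:E)%E.
Proof.
move=> u0; set A := [set w | _].
have mA : measurable A by exact: measurable_tail.
rewrite expr_div_n -expRM_natr EFinM -(expectation_exp_count _ _ u0).
rewrite lee_pdivlMr ?expR_gt0// muleC -[A]setIT -integral_indic//.
rewrite -ge0_integralZl//; last first.
  by apply/measurable_EFinP; exact: measurable_indic.
apply: ge0_le_integral => //.
- by apply: measurable_funeM; apply/measurable_EFinP; exact: measurable_indic.
- apply/measurable_EFinP; apply: measurableT_comp => //.
  exact: measurable_funM.
move=> w _; rewrite -EFinM lee_fin indicE.
have [|] := boolP (w \in A); last by rewrite mulr0 expR_ge0.
by rewrite inE /A/= mulr1 ler_expR -mulrA => /ler_wpM2l; exact.
Qed.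

(** [tilt_lt1] provides a [u] making the tail bound geometric with ratio [rho < 1], hence
    summable. *)
Lemma ae_count_lt b (c : R) : prb b < c ->
  \forall w \ae P, \forall N \near \oo,
    (\sum_(i < N) b (Z i w))%N%:R < c * N%:R.
Proof.
move=> bc; have [u u0 rho1] : exists2 u : R, 0 <= u &
    (1 + (expR u - 1) * prb b) / expR (u * c) < 1.
  by apply: tilt_lt1; rewrite bc fine_ge0.
set rho := (X in X < 1) in rho1.
have rho0 : 0 < rho.
  by rewrite divr_gt0 ?expR_gt0// ltr_wpDr// mulr_ge0 ?fine_ge0// subr_ge0
     -expR0 ler_expR.
pose F N := [set w | c * N%:R <= (\sum_(i < N) b (Z i w))%N%:R].
(* The event that infinitely many [F N] occur contains the exceptional set. *)
exists (lim_sup_set F); split.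
- apply: bigcap_measurableType => n _; apply: bigcup_measurable => k _.
  exact: measurable_tail.
- apply: lim_sup_set_cvg0 => [k|]; first exact: measurable_tail.
  apply: (@le_lt_trans _ _ (1 * (1 - rho)^-1)%:E); last by rewrite ltry.
  apply: lime_le; first exact: is_cvg_nneseries.
  apply: nearW => n; apply: le_trans (_ : (\sum_(0 <= k < n) (rho ^+ k)%:E <= _)%E).
    by apply: lee_sum => k _; exact: count_tail_le.
  rewrite sumEFin lee_fin.
  have := @geometric_le_lim R n 1 rho ler01 rho0.
  rewrite gtr0_norm// => /(_ rho1); rewrite /series/=.
  by under eq_bigr do rewrite mul1r.
- move=> w /= nw n _; apply: contrapT => nF; apply: nw; exists n => // N nN /=.
  by rewrite ltNge; apply/negP => FN; apply: nF; exists N.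
Qed.

(* [ae_count_lt] bounds the frequencies from above only; applied to the negation
   of [b] it bounds them from below. *)
Lemma ae_frequency_cvg b :
  \forall w \ae P,
    (\sum_(i < N) b (Z i w))%N%:R / N%:R @[N --> \oo] --> prb b.
Proof.
(* Restricting to the countably many margins [k.+1%:R^-1] lets one null set serve all of them. *)
have up (b' : pred T) : \forall w \ae P, forall k, \forall N \near \oo,
    (\sum_(i < N) b' (Z i w))%N%:R < (prb b' + k.+1%:R^-1) * N%:R.
  by apply: ae_foralln => k; apply: ae_count_lt; rewrite ltrDl.
have prC : prb (predC b) = 1 - prb b.
  (* Complements are taken on [Z 0], whose events are measurable and have the probabilities of those
     of [Z0]. *)
  have := event_prob b 0; have := event_prob (predC b) 0.
  rewrite (_ : [set w | predC b (Z 0 w)] = ~` [set w | b (Z 0 w)]); last first.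
    by apply/seteqP; split => w /=; move/negP.
  rewrite probability_setC// => EbC Eb.
  by apply: EFin_inj; rewrite -EbC EFinB -Eb.
have := up b; have := up (predC b); apply: filterS2 => w upC upb.
apply/cvgrPdist_lt => e e0.
have [k ke] : exists k, k.+1%:R^-1 < e.
  by have [k _ /(_ k (leqnn k))] := near_infty_natSinv_lt (PosNum e0); exists k.
have := upC k; have := upb k; have := nbhs_infty_gt 0; apply: filterS3.
move=> N N0 ub; rewrite prC.
have -> : (\sum_(i < N) predC b (Z i w))%N%:R =
    N%:R - (\sum_(i < N) b (Z i w))%N%:R :> R.
  apply/eqP; rewrite eq_sym subr_eq -natrD -big_split/=.
  rewrite (eq_bigr (fun=> 1%N)) ?sum1_card ?card_ord// => i _.
  by case: (b _).
have N0' : 0 < N%:R :> R by rewrite ltr0n.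
move: ub; rewrite -!ltr_pdivrMr// mulrBl divff ?gt_eqF// => ub lb.
move: (k.+1%:R^-1) ke ub lb => z ze ub lb.
by rewrite ltr_distlC; apply/andP; split; lra.
Qed.

End LargeNumbers.

(** * Empirical class-conditional distributions and the limsup bound *)

(** For [N > 0], the empirical probability is the frequency of [bXY] over that of [bY], the factors
    [N] cancelling; both frequencies converge. *)
Lemma ae_empirical_cvg {d : measure_display} {Omega : measurableType d}
    {R : realType} (P : probability Omega R) {S : finType} {r : nat}
    (a : 'I_r -> S) (XY : Omega -> S * bool) (Z : nat -> Omega -> S * bool)
    (y : bool) (j : 'I_r) :
  iid_sample P XY Z -> 0 < class_cond P a XY y j ->
  \forall w \ae P,
    empirical a (Z ^~ w) N y j @[N --> \oo] --> class_cond P a XY y j.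
Proof.
move=> hZ cc0; pose bY := [pred s : S * bool | s.2 == y].
pose bXY := [pred s : S * bool | (s.1 == a j) && (s.2 == y)].
have ccE : class_cond P a XY y j =
    fine (P (XY @^-1` [set x | bXY x])) / fine (P (XY @^-1` [set x | bY x])).
  rewrite /class_cond /cond_prob; congr (fine (P _) / fine (P _)).
    by apply/seteqP; split => w /=; [case=> -> ->; rewrite !eqxx|
      move=> /andP[/eqP-> /eqP->]].
  by apply/seteqP; split => w /= /eqP.
(* A null class would have conditional probability 0, division by 0 being 0. *)
have PY0 : fine (P (XY @^-1` [set x | bY x])) != 0.
  by apply/eqP => PY0; move: cc0; rewrite ccE PY0 invr0 mulr0 ltxx.
have := ae_frequency_cvg hZ bY; have := ae_frequency_cvg hZ bXY.
apply: filterS2 => w cXY cY; rewrite ccE.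
apply: cvg_trans (cvgM cXY (cvgV PY0 cY)); apply: near_eq_cvg.
near=> N.
have N0 : N%:R != 0 :> R.
  by rewrite pnatr_eq0 -lt0n; near: N; exact: nbhs_infty_gt.
rewrite /empirical /class_count/= invf_div mulrA mulfVK//.
rewrite mulrC; congr (_ * _); rewrite natr_sum; apply: eq_bigr => i _.
by rewrite -natrM mulnb.
Unshelve. all: by end_near.
Qed.

Theorem theorem1 (R : realType) (d : measure_display)
    (Omega : measurableType d) (P : probability Omega R)
    (r : nat) (S : finType) (a : 'I_r -> S) (ha : bijective a)
    (XY : Omega -> S * bool) (hXY : discrete_rv XY)
    (hY0 : (0 < P [set w | (XY w).2 = true])%E)
    (hY1 : (P [set w | (XY w).2 = true] < 1)%E)
    (Z : nat -> Omega -> S * bool) (hZ : iid_sample P XY Z) :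
  let p : 'I_r -> R := class_cond P a XY true in
  let q : 'I_r -> R := class_cond P a XY false in
  (forall j, 0 < p j) ->
  (forall j, 0 < q j) ->
  {ae P, forall w,
    let phat (N : nat) : 'I_r -> R := empirical a (Z ^~ w) N true in
    let qhat (N : nat) : 'I_r -> R := empirical a (Z ^~ w) N false in
    let C (N : nat) : R :=
      Num.max (sup_dist (phat N) p) (sup_dist (qhat N) q) in
    (limn_esup (fun N =>
       (`|jeffreys (phat N) (qhat N) - jeffreys p q| / C N)%:E)
     <= (\sum_(j < r) (`|1 + ln (p j / q j)| + `|1 + ln (q j / p j)|
                       + (p j ^+ 2 + q j ^+ 2) / (p j * q j)))%:E)%E}.
Proof.
move=> p q p0 q0.
have phat : \forall w \ae P, forall j,
    empirical a (Z ^~ w) N true j @[N --> \oo] --> p j.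
  by apply: filter_forall => j; exact: ae_empirical_cvg.
have qhat : \forall w \ae P, forall j,
    empirical a (Z ^~ w) N false j @[N --> \oo] --> q j.
  by apply: filter_forall => j; exact: ae_empirical_cvg.
apply: filterS2 phat qhat => w pw qw /=.
apply: le_trans (jeffreys_limsup p0 q0 pw qw) _; rewrite lee_fin.
apply: ler_sum => j _.
have -> : (p j ^+ 2 + q j ^+ 2) / (p j * q j) = q j / p j + p j / q j.
  by field; rewrite !gt_eqF.
(* [addrACA] pairs each logarithmic term with the ratio subtracted from it. *)
rewrite addrACA; apply: lerD; apply: le_trans (ler_normB _ _) _;
  by rewrite [X in _ + X <= _]ger0_norm// divr_ge0// ltW.
Qed.
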